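(* Let $F$ be a subset of $E(K_{n,n})$. If $F$ is not rigid, or if $n\nmid |F|$, then there exists a perfect matching $N$ of $K_{n,n}$ such that $|N\cap F|\ge\left\lfloor\frac{|F|}{n}\right\rfloor$ and $|N\setminus F|\ge\left\lfloor\frac{|E(K_{n,n})\setminus F|}{n}\right\rfloor$.
   Context: $K_{n,n}$ is the complete bipartite graph with $n$ vertices on each side; its edge set $E(K_{n,n})$ is identified with $[n]\times[n]$, where $[n]=\{1,\ldots,n\}$. A subset $F$ of $E(K_{n,n})$ is called rigid if there exist subsets $K$ and $L$ of $[n]$ such that $F=(K\times L)\cup\big(([n]\setminus K)\times([n]\setminus L)\big)$. *)

(* Defs.v *)
From mathcomp Require Import all_boot.

Set Implicit Arguments.
Unset Strict Implicit.
Unset Printing Implicit Defensive.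

(* The two sides of K_{n,n} are the two summands of 'I_n + 'I_n. The edge
   (i, j) : 'I_n * 'I_n joins inl i to inr j; the indices {1, ..., n} are
   shifted to {0, ..., n - 1}. *)
Definition incident (n : nat) (v : 'I_n + 'I_n) (e : 'I_n * 'I_n) : bool :=
  match v with
  | inl i => e.1 == i
  | inr j => e.2 == j
  end.

Definition perfect_matching (n : nat) (N : {set 'I_n * 'I_n}) : Prop :=
  forall v : 'I_n + 'I_n, #|[set e in N | incident v e]| = 1.

Definition rigid (n : nat) (F : {set 'I_n * 'I_n}) : Prop :=
  exists K L : {set 'I_n}, F = setX K L :|: setX (~: K) (~: L).

(* Main.v *)
Require Import Defs.
From mathcomp Require Import all_boot.
From mathcomp Require Import fingroup perm ssralg zmodp zify.

Set Implicit Arguments.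
Unset Strict Implicit.
Unset Printing Implicit Defensive.

(** View F as a 0/1 matrix x indexed by 'I_n * 'I_n.  A perfect matching is a
permutation s, and |N :&: F| is the number [hits x s] of ones of x on the graph
of s.  Write |F| = q n + r with 0 <= r < n.  The claim is that some s has
q hits, or, when r > 0, has q or q + 1 hits.

The n cyclic shifts partition the matrix, so some permutation has at most
|F| / n hits and some permutation has at least that many ([hits_average]).
Transpositions connect the two, hence somewhere on the way a single
transposition leads from fewer than q hits to at least q ([crossing]).  Such a
step changes two entries of the graph, so it gains at most 2: it arrives at
q or q + 1, which is the claim when r > 0.

When r = 0 and no permutation has q hits, the step goes from q - 1 to q + 1.
Permuting columns, it starts at the identity: x a a = x b b = 0 and
x a b = x b a = 1.  The claim is then that x is additive,
x i j = x i a (+) x a j for all i and j, which is rigidity ([gap_rigid]).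
Swaps, 3-cycles and one double swap of the identity, none of which may have q
hits, show:
- on the set Z of indices with x i i = 0, x is symmetric, and its zero entries
  form an equivalence relation, so x is there the adjacency matrix of a
  complete multipartite graph ([gap_sym], [gap_join]);
- if this graph has a triangle then every diagonal entry is 0
  ([gap_triangle_zeros]), so q = 1 and |F| = n; but each vertex is then adjacent
  to two of the three corners, so |F| >= 2 n.  Hence the graph is bipartite,
  that is, x is additive on Z ([gap_additive]).

The situation is self-dual: complementing x and swapping the columns a and b
turns the permutation with q + 1 hits into the identity with n - q - 1 ones,
where n - q hits are again avoided.  The indices outside Z now have a zero
diagonal entry, so additivity holds for them as well; the relations
[gap_mixed] between Z and its complement glue the two halves together. *)

(** * Counting hits of a permutation *)

Section Hits.
Variable T : finType.
Implicit Types (x : T -> T -> bool) (s t : {perm T}).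

Definition hits x s : nat := \sum_i x i (s i).

Definition permute_cols s x : T -> T -> bool := fun i j => x i (s j).

Definition complement x : T -> T -> bool := fun i j => ~~ x i j.

Lemma hits_permute_cols x s t : hits (permute_cols s x) t = hits x (t * s)%g.
Proof. by apply: eq_bigr => i _; rewrite /permute_cols permM. Qed.

Lemma hits_complement x s : hits (complement x) s + hits x s = #|T|.
Proof.
rewrite -big_split /= -sum1_card; apply: eq_bigr => i _.
by rewrite /complement; case: (x _ _).
Qed.

Lemma total_permute_cols x s :
  \sum_i \sum_j permute_cols s x i j = \sum_i \sum_j x i j.
Proof.
apply: eq_bigr => i _.
by rewrite [RHS](reindex_inj (@perm_inj _ s)).
Qed.

Lemma total_complement x :
  \sum_i \sum_j complement x i j + \sum_i \sum_j x i j = #|T| * #|T|.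
Proof.
rewrite -big_split /= -sum_nat_const; apply: eq_bigr => i _.
rewrite -big_split /= -sum1_card; apply: eq_bigr => j _.
by rewrite /complement; case: (x _ _).
Qed.

(** Only the rows moved by [t] contribute to the change from the identity; the
equation is stated without subtraction. *)
Lemma hits_switch x t (u : seq T) :
  uniq u -> (forall i, i \notin u -> t i = i) ->
  hits x t + \sum_(i <- u) x i i = hits x 1%g + \sum_(i <- u) x i (t i).
Proof.
move=> Uu fix_t; rewrite /hits.
rewrite (bigID (mem u)) [X in _ = X + _](bigID (mem u)) /=.
rewrite !(big_uniq _ Uu) /=.
have -> : \sum_(i | i \notin u) x i (t i) = \sum_(i | i \notin u) x i ((1%g : {perm T}) i).
  by apply: eq_bigr => i /fix_t ->; rewrite perm1.
have -> : \sum_(i in u) x i ((1%g : {perm T}) i) = \sum_(i in u) x i i.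
  by apply: eq_bigr => i _; rewrite perm1.
by rewrite addnAC [in RHS]addnAC; congr (_ + _); apply: addnC.
Qed.

Lemma hits_swap x i j : i != j ->
  hits x (tperm i j) + (x i i + x j j) = hits x 1%g + (x i j + x j i).
Proof.
move=> ij; have := @hits_switch x (tperm i j) [:: i; j].
rewrite !big_cons !big_nil tpermL tpermR !addn0; apply.
  by rewrite /= inE ij.
by move=> l; rewrite !inE => /norP[li lj]; rewrite tpermD // eq_sym.
Qed.

Lemma hits_cycle3 x i j k : i != j -> j != k -> i != k ->
  hits x (tperm i k * tperm i j)%g + (x i i + x j j + x k k) =
  hits x 1%g + (x i k + x j i + x k j).
Proof.
move=> ij jk ik.
have := @hits_switch x (tperm i k * tperm i j)%g [:: i; j; k].
rewrite !big_cons !big_nil !addn0 !addnA => -> //.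
- have kj : k != j by rewrite eq_sym.
  by rewrite !permM tpermL tpermR tpermL (tpermD ik jk) (tpermD ij kj) tpermR.
- by rewrite /= !inE negb_or ij jk ik.
move=> l; rewrite !inE !negb_or => /and3P[li lj lk].
by rewrite permM !tpermD // eq_sym.
Qed.

Lemma hits_swap2 x i j k l : uniq [:: i; j; k; l] ->
  hits x (tperm i j * tperm k l)%g + (x i i + x j j + x k k + x l l) =
  hits x 1%g + (x i j + x j i + x k l + x l k).
Proof.
move=> U; have := @hits_switch x (tperm i j * tperm k l)%g [:: i; j; k; l] U.
move: U; rewrite /= !inE !negb_or => /and4P[/and3P[ij ik il] /andP[jk jl] kl _].
rewrite !big_cons !big_nil !addn0 !addnA => -> //.
- rewrite !permM tpermL tpermR !(@tpermD _ i j) //.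
  by rewrite tpermL tpermR !(@tpermD _ k l) // eq_sym.
move=> m; rewrite !inE !negb_or => /and4P[mi mj mk ml].
by rewrite permM !tpermD // eq_sym.
Qed.

Lemma row_neq x i j : ~~ x i i -> x i j -> i != j.
Proof. by move=> zi; apply: contraTneq => <-. Qed.

Lemma diag_neq x i k : ~~ x i i -> x k k -> i != k.
Proof. by move=> zi; apply: contraTneq => <-. Qed.

(** * Matrices avoiding one more hit than the identity *)

Section Gap.
Variable x : T -> T -> bool.
Hypothesis avoid : forall s, hits x s != (hits x 1%g).+1.

(** The swap of [i] and [j] gains [x i j + x j i], which may not be 1. *)
Lemma gap_sym i j : ~~ x i i -> ~~ x j j -> x i j = x j i.
Proof.
move=> zi zj; have [-> //|ij] := eqVneq i j.
have := hits_swap x ij; have := avoid (tperm i j).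
rewrite (negbTE zi) (negbTE zj).
by case: (x i j); case: (x j i) => //=; lia.
Qed.

(** The 3-cycle i -> j -> k -> i gains [1 + x j k + x k i], which may not be 1.
Together with symmetry: being non-adjacent is a transitive relation. *)
Lemma gap_join i j k : ~~ x i i -> ~~ x j j -> ~~ x k k ->
  x i j -> x i k || x k j.
Proof.
move=> zi zj zk xij.
have [<-|ik] := eqVneq i k; first by rewrite xij orbT.
have [<-|jk] := eqVneq j k; first by rewrite xij.
have ij : i != j by exact: row_neq zi _.
rewrite eq_sym in jk.
have := hits_cycle3 x ik jk ij; have := avoid (tperm i j * tperm i k)%g.
rewrite xij (negbTE zi) (negbTE zj) (negbTE zk).
rewrite (gap_sym zk zi) (gap_sym zj zk).
by case: (x i k); case: (x k j) => //=; lia.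
Qed.

(** The 3-cycle i -> j -> k -> i gains [x j k + x k i], as it trades the one at
[(k, k)] for the one at [(i, j)]. *)
Lemma gap_mixed i j k : ~~ x i i -> ~~ x j j -> x k k -> x i j ->
  x j k = x k i.
Proof.
move=> zi zj ok xij.
have ij : i != j by exact: row_neq zi _.
have ik : i != k by exact: diag_neq zi _.
have jk : k != j by rewrite eq_sym; exact: diag_neq zj _.
have := hits_cycle3 x ik jk ij; have := avoid (tperm i j * tperm i k)%g.
rewrite xij (negbTE zi) (negbTE zj) ok.
by case: (x k i); case: (x j k) => //=; lia.
Qed.

(** Otherwise the swap of [i] and [k] gains two ones and loses one. *)
Lemma gap_mixed_nand i k : ~~ x i i -> x k k -> ~~ (x i k && x k i).
Proof.
move=> zi ok.
have ik : i != k by exact: diag_neq zi _.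
have := hits_swap x ik; have := avoid (tperm i k).
rewrite (negbTE zi) ok.
by case: (x k i); case: (x i k) => //=; lia.
Qed.

(** Suppose [x k k] for some [k].  By [gap_mixed] on the sides of the triangle,
the six entries joining [k] to the corners are all equal, hence 0 by
[gap_mixed_nand].  Swapping [i] with [j] gains 2 and swapping [k] with [l]
loses 1: the net gain is the forbidden 1. *)
Lemma gap_triangle_zeros i j l : ~~ x i i -> ~~ x j j -> ~~ x l l ->
  x i j -> x j l -> x i l -> forall k, ~~ x k k.
Proof.
move=> zi zj zl xij xjl xil k; apply/negP => ok.
have xji : x j i by rewrite (gap_sym zj zi).
have xlj : x l j by rewrite (gap_sym zl zj).
have xli : x l i by rewrite (gap_sym zl zi).
have e1 := gap_mixed zi zl ok xil.
have e2 := gap_mixed zl zi ok xli.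
have e3 := gap_mixed zj zi ok xji.
have e4 := gap_mixed zj zl ok xjl.
have := gap_mixed_nand zi ok.
have U : uniq [:: i; j; k; l].
  rewrite /= !inE !negb_or.
  have -> : i != j by exact: row_neq zi _.
  have -> : i != l by exact: row_neq zi _.
  have -> : j != l by exact: row_neq zj _.
  have -> : i != k by exact: diag_neq zi _.
  have -> : j != k by exact: diag_neq zj _.
  by have -> : k != l by rewrite eq_sym; exact: diag_neq zl _.
have := hits_swap2 x U; have := avoid (tperm i j * tperm k l)%g.
rewrite xij xji (negbTE zi) (negbTE zj) (negbTE zl) ok.
rewrite -e2 -e1 e4 -e3.
move: (hits x (_ * _)%g) (hits x 1%g) (x i k) => h h1; clear.
by case=> /=; lia.
Qed.

Hypothesis total : \sum_i \sum_j x i j = #|T| * (hits x 1%g).+1.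

(** A triangle empties the diagonal, so [total] says that the matrix has #|T|
ones.  But by [gap_join] each row has a one in at least two of the three
corner columns. *)
Lemma gap_no_triangle i j l : ~~ x i i -> ~~ x j j -> ~~ x l l ->
  ~~ [&& x i j, x j l & x i l].
Proof.
move=> zi zj zl; apply/and3P => -[xij xjl xil].
have z := gap_triangle_zeros zi zj zl xij xjl xil.
have ij : i != j by exact: row_neq zi _.
have il : i != l by exact: row_neq zi _.
have jl : j != l by exact: row_neq zj _.
have h1 : hits x 1%g = 0.
  by rewrite /hits big1 // => k _; rewrite perm1 (negbTE (z k)).
have deg k : 2 <= \sum_m x k m.
  rewrite (bigD1 i) //= (bigD1 j) 1?eq_sym //= (bigD1 l) /=; last first.
    by rewrite !(eq_sym l) il.
  have := gap_join (z i) (z j) (z k) xij.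
  have := gap_join (z j) (z l) (z k) xjl.
  have := gap_join (z i) (z l) (z k) xil.
  rewrite !(gap_sym (z _) (z k)).
  by case: (x k i); case: (x k j); case: (x k l) => //=; lia.
have : #|T| * 2 <= \sum_k \sum_m x k m.
  by rewrite -sum_nat_const leq_sum.
by have := fintype0 i; rewrite total h1; lia.
Qed.

(** Among three indices, [gap_join] excludes exactly one adjacency and
[gap_no_triangle] excludes three. *)
Lemma gap_additive i j k : ~~ x i i -> ~~ x j j -> ~~ x k k ->
  x i j = x i k (+) x k j.
Proof.
move=> zi zj zk.
have := gap_no_triangle zi zk zj.
have := gap_join zi zj zk; have := gap_join zi zk zj; have := gap_join zk zj zi.
rewrite (gap_sym zk zi) (gap_sym zj zk).
by case: (x i j); case: (x i k); case: (x k j) => //= h1 h2 h3;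
  do ?[by have := h1 isT | by have := h2 isT | by have := h3 isT].
Qed.

End Gap.

(** The matrix [y] is the dual one: the complement, read with the columns [a]
and [b] swapped.  It satisfies the hypotheses of [gap_additive], and its zero
diagonal entries are at [a], at [b] and where [x] has a diagonal one. *)
Lemma gap_rigid x a b :
  (forall s, hits x s != (hits x 1%g).+1) ->
  \sum_i \sum_j x i j = #|T| * (hits x 1%g).+1 ->
  ~~ x a a -> ~~ x b b -> x a b -> x b a ->
  forall i j, x i j = x i a (+) x a j.
Proof.
move=> avoid total za zb xab xba.
have ab : a != b by exact: row_neq za _.
pose y := permute_cols (tperm a b) (complement x).
have hy s : hits y s + hits x (s * tperm a b)%g = #|T|.
  by rewrite hits_permute_cols hits_complement.
have y1 : hits y 1%g + (hits x 1%g).+2 = #|T|.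
  rewrite -(hy 1%g) mul1g; have := hits_swap x ab.
  by rewrite (negbTE za) (negbTE zb) xab xba; lia.
have avoid_y s : hits y s != (hits y 1%g).+1.
  by have := hy s; have := avoid (s * tperm a b)%g; lia.
have total_y : \sum_i \sum_j y i j = #|T| * (hits y 1%g).+1.
  by rewrite total_permute_cols; have := total_complement x; rewrite total; nia.
have add_y := gap_additive avoid_y total_y.
have ya i : y i a = ~~ x i b by rewrite /y /permute_cols /complement tpermL.
have yb i : y i b = ~~ x i a by rewrite /y /permute_cols /complement tpermR.
have yD i k : x k k -> y i k = ~~ x i k.
  move=> ok; rewrite /y /permute_cols /complement tpermD //.
    by exact: diag_neq za _.
  by exact: diag_neq zb _.
have ny_a : ~~ y a a by rewrite ya xab.
have ny_b : ~~ y b b by rewrite yb xba.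
have ny k : x k k -> ~~ y k k by move=> ok; rewrite yD // ok.
have mixed := gap_mixed avoid.
have ab_k k : x k k -> x k a = ~~ x a k.
  move=> ok; have := add_y a b k ny_a ny_b (ny _ ok).
  by rewrite !yb yD // (negbTE za); case: (x k a); case: (x a k).
have bk k : x k k -> x b k = ~~ x a k.
  by move=> ok; rewrite (mixed a b k) // ab_k.
have adj i : ~~ x i i -> ~~ x i a -> x i b /\ x b i.
  move=> zi xia; have := gap_join avoid za zb zi xab.
  rewrite (gap_sym avoid za zi) (negbTE xia) /= => xib.
  by rewrite (gap_sym avoid zb zi).
(* For an index with diagonal entry 0 adjacent to [a], compare through the edge
   to [a]; otherwise it is adjacent to [b] by [adj], and the edge to [b] serves. *)
move=> i j; case: (boolP (x i i)) => [oi|zi]; case: (boolP (x j j)) => [oj|zj].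
- have := add_y i j b (ny _ oi) (ny _ oj) ny_b.
  by rewrite yb !yD // bk //; case: (x i j); case: (x i a); case: (x a j).
- case: (boolP (x a j)) => xaj.
    have xja : x j a by rewrite (gap_sym avoid zj za).
    by rewrite -(mixed j a i) // ab_k //; case: (x a i).
  have [|xjb xbj] := adj j zj; first by rewrite (gap_sym avoid zj za).
  by rewrite addbF -(mixed j b i) // bk // ab_k.
- case: (boolP (x i a)) => xia.
    have xai : x a i by rewrite (gap_sym avoid za zi).
    by rewrite (mixed a i j) // ab_k.
  have [xib xbi] := adj i zi xia.
  by rewrite (mixed b i j) // -(mixed b a j).
exact: (gap_additive avoid total).
Qed.

(** * Walking between permutations by transpositions *)

(** Transpositions generate the symmetric group, so a set of permutations that
is closed under them and is not empty contains every permutation. *)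
Lemma crossing (P : pred {perm T}) s0 s1 : P s0 -> ~~ P s1 ->
  exists s i j, P s /\ ~~ P (tperm i j * s)%g.
Proof.
move=> P0 P1.
case: (boolP [exists s, exists i, exists j, P s && ~~ P (tperm i j * s)%g]).
  by move=> /existsP[s /existsP[i /existsP[j /andP[? ?]]]]; exists s, i, j.
move=> none; case/negP: P1.
have [ts def_ts _] := prod_tpermP (s1 * s0^-1)%g.
have -> : s1 = ((\prod_(t <- ts) tperm t.1 t.2) * s0)%g by rewrite -def_ts mulgKV.
elim: ts {def_ts} => [|t ts IH]; first by rewrite big_nil mul1g.
rewrite big_cons -mulgA; apply: contraNT none => nP.
apply/existsP; exists ((\prod_(t <- ts) tperm t.1 t.2) * s0)%g.
by apply/existsP; exists t.1; apply/existsP; exists t.2; rewrite IH.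
Qed.

Lemma hits_step x s i j : hits x (tperm i j * s)%g <= (hits x s).+2 /\
  (hits x (tperm i j * s)%g = (hits x s).+2 ->
   [/\ ~~ x i (s i), ~~ x j (s j), x i (s j) & x j (s i)]).
Proof.
have [->|ij] := eqVneq i j.
  by rewrite tperm1 mul1g; split=> [|]; lia.
have := hits_swap (permute_cols s x) ij; rewrite !hits_permute_cols mul1g /permute_cols.
by case: (x i (s i)); case: (x j (s j)); case: (x i (s j)); case: (x j (s i)) => /=;
  split=> //; lia.
Qed.

End Hits.

(** The cyclic shifts [rot c] pass through every entry exactly once, so their
numbers of hits add up to the total; the extremal shifts are the witnesses. *)
Lemma hits_average n (x : 'I_n.+1 -> 'I_n.+1 -> bool) :
  (exists s, hits x s * n.+1 <= \sum_i \sum_j x i j) /\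
  (exists s, \sum_i \sum_j x i j <= hits x s * n.+1).
Proof.
pose rot (c : 'I_n.+1) : {perm 'I_n.+1} := perm (@GRing.addrI _ c).
have sum_rot : \sum_c hits x (rot c) = \sum_i \sum_j x i j.
  rewrite exchange_big /=; apply: eq_bigr => i _.
  rewrite [RHS](reindex_inj (@GRing.addIr _ i)) /=.
  by apply: eq_bigr => c _; rewrite permE.
rewrite -sum_rot; split.
  case: (arg_minnP (fun c => hits x (rot c)) (isT : predT (ord0 : 'I_n.+1))).
  move=> c _ minc; exists (rot c).
  rewrite mulnC -[X in X * _]card_ord -sum_nat_const.
  by apply: leq_sum => d _; apply: minc.
case: (arg_maxnP (fun c => hits x (rot c)) (isT : predT (ord0 : 'I_n.+1))).
move=> c _ maxc; exists (rot c).
rewrite mulnC -[X in X * _]card_ord -sum_nat_const.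
by apply: leq_sum => d _; apply: maxc.
Qed.

(** In terms of q = total %/ n and r = total %% n, the strict upper bound on
[hits x s * n] means at most q + 1 hits, and at most q hits when r = 0. *)
Lemma fair_perm n (x : 'I_n.+1 -> 'I_n.+1 -> bool) :
  let total := \sum_i \sum_j x i j in
  (exists s, total %/ n.+1 <= hits x s /\ hits x s * n.+1 < total + n.+1) \/
  n.+1 %| total /\
    exists a b : 'I_n.+1 -> bool, forall i j, x i j = (a i == b j).
Proof.
move=> total; set q := total %/ n.+1.
have [[s0 le0] [s1 ge1]] := hits_average x; rewrite -/total in le0 ge1.
have eq_total := divn_eq total n.+1; rewrite -/q in eq_total.
have lt_r : total %% n.+1 < n.+1 by rewrite ltn_mod.
case: (boolP [exists s, (q <= hits x s) && (hits x s * n.+1 < total + n.+1)]).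
  by case/existsP=> s /andP[? ?]; left; exists s.
move=> /existsPn none; right.
have low0 : hits x s0 < q by have := none s0; nia.
have high1 : ~~ (hits x s1 < q) by nia.
have [s [i [j [low]]]] := crossing (P := fun s => hits x s < q) low0 high1.
rewrite -leqNgt => high.
have [step jump] := hits_step x s i j.
(* The step jumps over every allowed value, which its length 2 permits only when
   q is the sole allowed value, that is when r = 0. *)
have gap := none (tperm i j * s)%g; rewrite high /= -leqNgt in gap.
have r0 : total %% n.+1 = 0 by nia.
have hs : q = (hits x s).+1 by nia.
have [|zi zj xij xji] := jump; first by nia.
split; first by rewrite /dvdn r0.
pose y := permute_cols s x.
have y1 : hits y 1%g = hits x s by rewrite hits_permute_cols mul1g.
have avoid t : hits y t != (hits y 1%g).+1.
  rewrite y1 -hs hits_permute_cols; have := none (t * s)%g.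
  by apply: contraNneq => ->; nia.
have total_y : \sum_k \sum_l y k l = #|'I_n.+1| * (hits y 1%g).+1.
  by rewrite total_permute_cols y1 -hs card_ord -/total; nia.
have add_y := gap_rigid avoid total_y zi zj xij xji.
exists (fun k => x k (s i)), (fun l => ~~ x i l) => k l.
have := add_y k ((s^-1)%g l); rewrite /y /permute_cols permKV => ->.
by case: (x k _); case: (x i l).
Qed.

(** * From permutations to perfect matchings *)

Definition perm_matching n (s : {perm 'I_n}) : {set 'I_n * 'I_n} :=
  [set e | e.2 == s e.1].

Lemma perm_matchingP n (s : {perm 'I_n}) : perfect_matching (perm_matching s).
Proof.
case=> [i|j]; apply/eqP/cards1P.
  exists (i, s i); apply/setP => -[k l]; rewrite !inE /= xpair_eqE andbC.
  by case: eqP => // ->.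
exists ((s^-1)%g j, j); apply/setP => -[k l]; rewrite !inE /= xpair_eqE andbC.
by case: eqP => [->|]; rewrite ?andbF // andbT eq_sym (canF_eq (permK s)).
Qed.

Lemma card_perm_matching n (s : {perm 'I_n}) (A : {set 'I_n * 'I_n}) :
  #|perm_matching s :&: A| = hits (fun i j => (i, j) \in A) s.
Proof.
rewrite /hits -big_mkcond /= sum1_card -(card_imset _ (f := fun i => (i, s i))).
  apply: eq_card => -[k l]; rewrite !inE /=; apply/andP/imsetP.
    by case=> /eqP-> kA; exists k.
  by case=> i iA [-> ->].
by move=> i j [].
Qed.

Lemma card_entries n (A : {set 'I_n * 'I_n}) :
  #|A| = \sum_i \sum_j ((i, j) \in A : nat).
Proof.
by rewrite pair_bigA /= -sum1_card big_mkcond; apply: eq_bigr => -[i j] _ /=; case: (_ \in _).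
Qed.

Theorem corollary5p5 (n : nat) (F : {set 'I_n * 'I_n})
    (hF : ~ rigid F \/ ~~ (n %| #|F|)) :
  exists N : {set 'I_n * 'I_n},
    [/\ perfect_matching N,
        #|N :&: F| >= #|F| %/ n
      & #|N :\: F| >= #|[set: 'I_n * 'I_n] :\: F| %/ n].
Proof.
case: n => [|n] in F hF *.
  by exists set0; split=> [[[]|[]]||] //; rewrite divn0.
pose x i j := (i, j) \in F.
have cardF : #|F| = \sum_i \sum_j x i j := card_entries F.
have [[s [lo hi]]|[div [a [b xab]]]] := fair_perm x; last first.
  case: hF => [[]|]; last by rewrite cardF div.
  exists [set i | a i], [set j | b j]; apply/setP => -[i j].
  by rewrite !inE /= -[LHS]/(x i j) xab; case: (a i); case: (b j).
exists (perm_matching s); split; first exact: perm_matchingP.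
  by rewrite card_perm_matching cardF.
have card_s : #|perm_matching s| = n.+1.
  rewrite -[perm_matching s]setIT card_perm_matching -[RHS]card_ord -sum1_card.
  by apply: eq_bigr => i _; rewrite inE.
have split_s := cardsID F (perm_matching s).
rewrite card_s card_perm_matching -/x in split_s.
have split_T := cardsID F [set: 'I_n.+1 * 'I_n.+1].
rewrite setTI cardsT card_prod card_ord in split_T.
by rewrite -cardF in hi; rewrite -ltnS ltn_divLR //; nia.
Qed.
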